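(* Let $d\ge1$ and $n\ge 0$ with $d$ dividing $n$, and let $\mu$ be the Möbius function of $\Omega_n^{(d)}$. Then: (a) For ordered set partitions $\psi\le\omega$ in $\Omega_n^{(d)}$ (both different from $\hat0$), $\mu(\psi,\omega)=(-1)^{\operatorname{rk}(\psi,\omega)}$. (b) $\mu(\Omega_n^{(d)}):=\mu(\hat0,\hat1)=\mathcal{E}_n^{(d)}$. (c) For an ordered set partition $\omega=(B_1,\ldots,B_k)$ in $\Omega_n^{(d)}$ with $\#B_i=\alpha_i$, $\mu(\hat0,\omega)=(-1)^{k-1}\prod_{i=1}^k\mathcal{E}^{(d)}_{\alpha_i}$.
   Context: $[n]=\{1,\ldots,n\}$. An ordered set partition of $[n]$ is a sequence $(B_1,\ldots,B_k)$ of nonempty pairwise disjoint sets (blocks) with union $[n]$; it is $d$-divisible if every block has size divisible by $d$. The $d$-divisible ordered set partitions of $[n]$ are ordered by: $(B_1,\ldots,B_k)$ is covered by each $(B_1,\ldots,B_{i-1},B_i\cup B_{i+1},B_{i+2},\ldots,B_k)$, extended transitively; $\Omega_n^{(d)}$ is this poset with a unique minimum $\hat0$ adjoined. It has maximum $\hat1=([n])$ and is ranked; $\operatorname{rk}(\psi,\omega)=\operatorname{rk}\omega-\operatorname{rk}\psi$. The $d$-divisible Euler numbers $\mathcal{E}_n^{(d)}$ are defined by $\sum_{n\ge0}\mathcal{E}_n^{(d)}x^n/n! = 1/(1+x^d/d!+x^{2d}/(2d)!+\cdots)$. *)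

(* Defs.v *)
From HB Require Import structures.
From mathcomp Require Import all_boot all_order all_algebra.

Set Implicit Arguments.
Unset Strict Implicit.
Unset Printing Implicit Defensive.

Import Order.TTheory GRing.Theory Num.Theory.
Local Open Scope ring_scope.

Section FinitePosets.

Variables (disp : Order.disp_t) (P : finPOrderType disp).
Implicit Types x y z : P.

(* The recursion mu(x,x) = 1, mu(x,y) = - \sum_(x <= z < y) mu(x,z), run on   *)
(* a number of steps [k] which is large enough when k = #|P|: see moebiusE.   *)
Fixpoint moebius_rec (k : nat) x y : int :=
  if x == y then 1
  else if k is k'.+1 then
    - \sum_(z : P | (x <= z)%O && (z < y)%O) moebius_rec k' x z
  else 0.

Definition moebius x y : int := moebius_rec #|P| x y.

Definition is_chain (C : {set P}) :=
  [forall x in C, forall y in C, (x >=< y)%O].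

(* Length (number of elements minus one) of a longest chain ending at x.      *)
(* In a ranked poset all maximal chains ending at x have this length.         *)
Definition rank x : nat :=
  (\max_(C : {set P} | is_chain C && [forall z in C, (z <= x)%O]) #|C|).-1.

(* rk(x,y); only used for x <= y, where the subtraction does not truncate.    *)
Definition rank_interval x y : nat := (rank y - rank x)%N.

Lemma moebius_rec_stable k l x y :
  (#|[set z | (z < y)%O]| <= k)%N -> (#|[set z | (z < y)%O]| <= l)%N ->
  moebius_rec k x y = moebius_rec l x y.
Proof.
have down z w : (z < w)%O ->
    (#|[set u : P | (u < z)%O]| < #|[set u : P | (u < w)%O]|)%N.
  move=> zw; apply/proper_card/properP; split.
    by apply/subsetP => u; rewrite !inE => /lt_trans; apply.
  by exists z; rewrite !inE ?ltxx.
have rec0 j : forall u v, #|[set z | (z < v)%O]| = 0%N ->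
    moebius_rec j u v = (u == v)%:R.
  move=> u v /eqP; rewrite cards_eq0 => /eqP v0.
  case: j => [|j] /=; case: eqP => // _.
  rewrite big1 ?oppr0 // => z /andP[_ zv].
  by have := in_set0 z; rewrite -v0 inE zv.
elim: k l x y => [|k IHk] [|l] x y //.
- by rewrite leqn0 => /eqP y0 _; rewrite !rec0.
- by move=> _; rewrite leqn0 => /eqP y0; rewrite !rec0.
move=> yk yl /=; case: eqP => // _; congr (- _).
apply: eq_bigr => z /andP[_ zy]; apply: IHk.
  by rewrite -ltnS (leq_trans (down _ _ zy)).
by rewrite -ltnS (leq_trans (down _ _ zy)).
Qed.

Lemma moebiusE x y :
  moebius x y =
    if x == y then 1
    else - \sum_(z : P | (x <= z)%O && (z < y)%O) moebius x z.
Proof.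
have -> : moebius x y = moebius_rec #|P|.+1 x y.
  by apply: moebius_rec_stable; rewrite ?leqW ?max_card.
by [].
Qed.

End FinitePosets.

Section OrderedSetPartitions.

Variables d n : nat.

(* d-divisible ordered set partitions, as the sequence of their blocks; the   *)
(* ground set [n] is 'I_n = {0, ..., n-1}. There is at least one block, which *)
(* only matters when n = 0: the empty set has no ordered set partition.       *)
Definition is_osp (s : seq {set 'I_n}) :=
  [&& s != [::],
      all (fun B : {set 'I_n} => B != set0) s,
      all (fun B : {set 'I_n} => d %| #|B|)%N s,
      pairwise (fun A B : {set 'I_n} => [disjoint A & B]) s
    & \bigcup_(B <- s) B == [set: 'I_n]].

Record osp := Osp { blocks :> seq {set 'I_n}; _ : is_osp blocks }.

HB.instance Definition _ := [isSub for blocks].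
HB.instance Definition _ := [Choice of osp by <:].

Implicit Types (s t : seq {set 'I_n}) (x y z : osp).

Lemma disjoint_bigcup (B : {set 'I_n}) s :
  all (fun C : {set 'I_n} => [disjoint B & C]) s ->
  [disjoint B & \bigcup_(C <- s) C].
Proof.
elim: s => [|C s IHs] /=; first by rewrite big_nil -setI_eq0 setI0.
case/andP=> BC /IHs; rewrite big_cons -!setI_eq0 setIUr setU_eq0 => ->.
by rewrite setI_eq0 BC.
Qed.

Lemma size_osp x : (size x <= n)%N.
Proof.
case: x => s /= /and5P[_ s0 _ sI _].
suff: (size s <= #|\bigcup_(B <- s) B|)%N.
  by move/leq_trans; apply; rewrite -[leqRHS]card_ord max_card.
elim: s s0 sI => [|B s IHs] //= /andP[B0 s0] /andP[BI sI].
rewrite big_cons cardsU.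
have /eqP -> : B :&: \bigcup_(A <- s) A == set0.
  by rewrite setI_eq0 disjoint_bigcup.
by rewrite cards0 subn0 -add1n leq_add ?card_gt0 ?IHs.
Qed.

Lemma osp_bseqK :
  pcancel (fun x => Bseq (size_osp x)) (fun s : n.-bseq {set 'I_n} => insub (s : seq _)).
Proof. by move=> x; rewrite /= valK. Qed.

HB.instance Definition _ := Countable.copy osp (pcan_type osp_bseqK).
HB.instance Definition _ : isFinite osp := PCanIsFinite osp_bseqK.

(* (B_1, ..., B_i \cup B_(i+1), ..., B_k), where i is counted from 0.         *)
Definition merge_blocks s (i : nat) :=
  take i s ++ (nth set0 s i :|: nth set0 s i.+1) :: drop i.+2 s.

(* y covers x.                                                                *)
Definition osp_cover : rel osp :=
  fun x y => [exists i : 'I_(size x).-1, val y == merge_blocks x i].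

Definition osp_le : rel osp := connect osp_cover.

Lemma osp_cover_size x y : osp_cover x y -> size x = (size y).+1.
Proof.
case/existsP=> i /eqP ->; have := ltn_ord i; move: (i : nat) => {}i ix.
rewrite size_cat /= size_takel ?size_drop; last exact/ltnW/(leq_trans ix)/leq_pred.
by rewrite addnS -subSS; case: (size x) ix => [|[|m]] // im; rewrite !subSS subnKC.
Qed.

Lemma osp_le_size x y : osp_le x y -> (size y <= size x ?= iff (x == y))%N.
Proof.
case/connectP=> p; elim: p x => [|z p IHp] x /=.
  by move=> _ ->; rewrite eqxx; apply/leqif_refl.
case/andP=> /osp_cover_size xz /IHp{}IHp /IHp[zy _].
have yx : (size y < size x)%N by rewrite xz ltnS.
split; first exact: ltnW.
by rewrite ltn_eqF //; case: eqP yx => // ->; rewrite ltnn.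
Qed.

(* The d-divisible ordered set partitions of [n] with a minimum adjoined:     *)
(* None is the added minimum, Some x is the ordered set partition x.          *)
Definition Omega : Type := option osp.

HB.instance Definition _ := Finite.on Omega.

Definition of_osp (x : osp) : Omega := Some x.

Definition Omega_le (x y : Omega) :=
  match x, y with
  | None, _ => true
  | Some _, None => false
  | Some x, Some y => osp_le x y
  end.

Lemma Omega_le_refl : reflexive Omega_le.
Proof. by case=> //= x; apply: connect0. Qed.

Lemma Omega_le_anti : antisymmetric Omega_le.
Proof.
case=> [x|] [y|] //= /andP[/osp_le_size xy /osp_le_size yx].
congr Some; apply/eqP; rewrite -(xy.2) eqn_leq xy /=; exact: yx.1.
Qed.

Lemma Omega_le_trans : transitive Omega_le.
Proof. by case=> [y|] [x|] [z|] //=; apply: connect_trans. Qed.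

Fact Omega_display : Order.disp_t. Proof. exact: Order.Disp tt tt. Qed.

HB.instance Definition _ := Order.Le_isPOrder.Build Omega_display Omega
  Omega_le_refl Omega_le_anti Omega_le_trans.

HB.instance Definition _ := Order.hasBottom.Build Omega_display Omega
  (bottom := None) (fun=> isT).

(* The one-block partition ([n]). For n = 0 it has an empty block, hence is   *)
(* not an ordered set partition, and insub returns None: the poset is then    *)
(* reduced to its minimum, which is also its maximum.                         *)
Definition Omega_top : Omega := insub [:: [set: 'I_n]].

Lemma Omega_top_max : (d %| n)%N -> forall x : Omega, (x <= Omega_top)%O.
Proof.
move=> dn [x|] //; have [m] := ubnP (size x); elim: m x => // m IHm [s sP] /= sm.
have [_ s0 sd sI sU] := and5P sP.
case: s sP sm s0 sd sI sU => [|A [|B s]] //= sP sm.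
  move=> s0 _ _; rewrite big_seq1 => /eqP AT; rewrite {}AT in sP *.
  by rewrite /Omega_top insubT; apply: connect0.
case/and3P=> A0 B0 s0 /and3P[dA dB ds] /and3P[/andP[AB As] Bs sI].
rewrite !big_cons setUA => sU.
have tP : is_osp (A :|: B :: s).
  apply/and5P; split=> //=.
  - by rewrite setU_eq0 negb_and A0.
  - rewrite ds cardsU; move: AB; rewrite -setI_eq0 => /eqP ->.
    by rewrite cards0 subn0 dvdn_add.
  - rewrite sI andbT; apply/allP => C Cs.
    rewrite -setI_eq0 setIUl setU_eq0 !setI_eq0.
    by rewrite (allP As) ?(allP Bs).
  by rewrite big_cons.
apply: (@Omega_le_trans (Some (Osp tP))); last exact: IHm.
apply/connect1/existsP.
by exists (@Ordinal (size s).+1 0 isT); rewrite /merge_blocks /= drop0.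
Qed.

End OrderedSetPartitions.

Section FormalPowerSeries.

Variable F : fieldType.

(* A formal power series over F is its sequence of coefficients nat -> F.     *)
Definition fps_mul (f g : nat -> F) : nat -> F :=
  fun n => \sum_(i < n.+1) f i * g (n - i)%N.

Definition fps_one : nat -> F := fun n => (n == 0)%:R.

(* The first n coefficients of 1 / f, by solving f * g = 1 degree by degree.  *)
Fixpoint fps_inv_seq (f : nat -> F) (n : nat) : seq F :=
  if n is m.+1 then
    let s := fps_inv_seq f m in
    rcons s ((fps_one m - \sum_(i < m) s`_i * f (m - i)%N) / f 0)
  else [::].

Definition fps_inv (f : nat -> F) : nat -> F :=
  fun n => (fps_inv_seq f n.+1)`_n.

Lemma fps_mulVf (f : nat -> F) :
  f 0 != 0 -> fps_mul (fps_inv f) f =1 fps_one.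
Proof.
move=> f0 n.
have size_inv m : size (fps_inv_seq f m) = m.
  by elim: m => //= m IHm; rewrite size_rcons IHm.
have nth_inv m : forall i, (i < m)%N -> (fps_inv_seq f m)`_i = fps_inv f i.
  elim: m => // m IHm i; rewrite ltnS leq_eqVlt => /predU1P[-> //|im].
  by rewrite /= nth_rcons size_inv im IHm.
rewrite /fps_mul big_ord_recr /= subnn.
rewrite {2}/fps_inv /= nth_rcons size_inv ltnn eqxx divfK //.
under eq_bigr => i _ do rewrite /= -(nth_inv _ _ (ltn_ord i)).
by rewrite addrC subrK.
Qed.

End FormalPowerSeries.

(* 1 + x^d/d! + x^(2d)/(2d)! + ...                                            *)
Definition divisible_exp (d : nat) : nat -> rat :=
  fun n => if (d %| n)%N then (n`!)%:R^-1 else 0.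

Definition euler (d n : nat) : rat := (n`!)%:R * fps_inv (divisible_exp d) n.

Lemma euler_egf (d : nat) :
  fps_mul (fun n => euler d n / (n`!)%:R) (divisible_exp d) =1 fps_one rat.
Proof.
move=> n; rewrite -(fps_mulVf (f := divisible_exp d)); last first.
  by rewrite /divisible_exp dvdn0 invr_eq0 oner_eq0.
apply: eq_bigr => i _; rewrite /euler [_ * fps_inv _ _]mulrC mulfK //.
by rewrite pnatr_eq0 -lt0n fact_gt0.
Qed.

(* Main.v *)
Require Import Defs.
From mathcomp Require Import all_boot all_order all_algebra.
From mathcomp Require Import zify ring.

Set Implicit Arguments.
Unset Strict Implicit.
Unset Printing Implicit Defensive.

Import Order.TTheory GRing.Theory Num.Theory.
Local Open Scope ring_scope.

(* The cuts of omega are among the cuts of psi when psi <= omega, and the     *)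
(* interval [psi, omega] is the Boolean algebra of the sets of cuts in        *)
(* between; so (-1)^(number of blocks) sums to zero over it unless psi =      *)
(* omega. For the intervals [0^, omega], put w(B_1, ..., B_k) = prod_i (-     *)
(* E_|B_i|). The claim is mu(0^, z) = - w(z), that is, w sums to 1 over the   *)
(* refinements of omega. Choosing the first piece A of the first block B and  *)
(* summing over the rest by induction, this becomes sum_A (- E_|A|) = 1, A    *)
(* ranging over the nonempty subsets of B with d | |A|. This is the           *)
(* coefficient of x^|B| / |B|! in the identity (sum_n E_n x^n/n!) (1 + x^d/d! *)
(* + x^(2d)/(2d)! + ...) = 1.                                                 *)

(** [osp_leE] replaces the order generated by merges with the recursive test [refines], so that both
    kinds of intervals can be listed: by [coarsenings] above a partition, by [refinements] below
    one. [moebius_unique] then reduces each value of the Möbius function to a sum over an interval.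
    Between partitions this sum is [sum_coarsenings]; from the minimum it is [sum_refinements],
    which rests on the Euler identity [euler_sum_subsets]. [rank_osp] turns signs given by block
    counts into signs given by ranks, and (b) is (c) at the one-block partition. *)

Section Refinement.

Variables d n : nat.
Implicit Types (A B C : {set 'I_n}) (s t z : seq {set 'I_n}) (x y : osp d n).

(** * Refinement of sequences of blocks *)

Definition residue A B t := if A == B then t else B :\: A :: t.

(* [s] is obtained from [t] by cutting each block of [t] into consecutive     *)
(* pieces, which are removed one at a time from the front of [t].             *)
Fixpoint refines s t : bool :=
  match s, t with
  | [::], [::] => true
  | A :: s', B :: t' => (A \subset B) && refines s' (residue A B t')
  | _, _ => false
  end.

Definition disjoint_blocks s := pairwise (fun A B => [disjoint A & B]) s.

Definition good_block B := (B != set0) && (d %| #|B|)%N.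

Lemma disjoint_bigcupE B s :
  all (fun C => [disjoint B & C]) s = [disjoint B & \bigcup_(C <- s) C].
Proof.
apply/idP/idP; first exact: disjoint_bigcup.
elim: s => //= C s IHs; rewrite big_cons -!setI_eq0 setIUr setU_eq0 setI_eq0.
by case/andP => -> ; rewrite setI_eq0.
Qed.

Lemma is_ospE s :
  is_osp d s = [&& s != [::], all good_block s, disjoint_blocks s
                 & \bigcup_(B <- s) B == [set: 'I_n]].
Proof. by rewrite /is_osp (all_predI (fun B => B != set0)) -!andbA. Qed.

Lemma setU_diff A B : A \subset B -> A :|: (B :\: A) = B.
Proof. by move=> /setIidPr AB; rewrite -{1}AB setID. Qed.

Lemma setUDK A C : [disjoint A & C] -> (A :|: C) :\: A = C.
Proof.
by move=> AC; rewrite setDUl setDv set0U; apply/setDidPl; rewrite disjoint_sym.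
Qed.

Lemma disjoint_subset0 A C : [disjoint A & C] -> C \subset A -> C = set0.
Proof. by move=> /disjoint_setI0 <- /setIidPr. Qed.

Lemma good_diff A B :
  good_block A -> good_block B -> A \subset B -> A != B -> good_block (B :\: A).
Proof.
case/andP=> A0 dA /andP[B0 dB] AB nAB; apply/andP; split.
  by rewrite setD_eq0; apply: contra nAB => BA; rewrite eqEsubset AB.
by rewrite cardsD (setIidPr AB) dvdn_sub.
Qed.

Lemma good_residue A B t :
  good_block A -> A \subset B -> all good_block (B :: t) ->
  all good_block (residue A B t).
Proof.
rewrite /residue /= => gA AB /andP[gB gt]; case: eqVneq => //= nAB.
by rewrite gt good_diff.
Qed.

Lemma refines_refl s : refines s s.
Proof. by elim: s => //= A s IHs; rewrite subxx /residue eqxx. Qed.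

Lemma refines_nilr s : refines s [::] = (s == [::]).
Proof. by case: s. Qed.

Lemma refines_cover s t :
  refines s t -> \bigcup_(B <- s) B = \bigcup_(B <- t) B.
Proof.
elim: s t => [|A s IHs] [|B t] //= /andP[AB /IHs]; rewrite !big_cons /residue.
case: eqP => [-> -> //|_ ->]; by rewrite big_cons setUA setU_diff.
Qed.

Lemma refines_disjoint s t :
  refines s t -> disjoint_blocks s = disjoint_blocks t.
Proof.
rewrite /disjoint_blocks.
elim: s t => [|A s IHs] [|B t] //= /andP[AB st].
rewrite !disjoint_bigcupE (IHs _ st) (refines_cover st) /residue.
case: eqP => [-> //|_] /=; rewrite big_cons disjoint_bigcupE andbA.
congr (_ && _); rewrite -!setI_eq0 setIUr setU_eq0 setIDA setIC -setIDA setDv setI0 eqxx /=.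
by rewrite -{2}(setU_diff AB) setIUl setU_eq0.
Qed.

Lemma refines_good s t : refines s t -> all good_block s -> all good_block t.
Proof.
elim: s t => [|A s IHs] [|B t] //= /andP[AB /IHs gt] /andP[/andP[A0 dA] /gt].
rewrite /residue; case: eqP => [<-|_] /=; first by rewrite /good_block A0 dA.
case/andP=> /andP[_ dBA] ->; rewrite andbT /good_block; apply/andP; split.
  by apply: contraNneq A0 => B0; rewrite B0 subset0 in AB.
rewrite -(setU_diff AB) cardsU setIDA setIC -setIDA setDv setI0.
by rewrite cards0 subn0 dvdn_add.
Qed.

Lemma osp_coarsen s t : is_osp d s -> refines s t -> is_osp d t.
Proof.
rewrite !is_ospE => /and4P[s0 gs ds cs] st; apply/and4P; split.
- by apply: contraNneq s0 => t0; rewrite t0 refines_nilr in st.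
- exact: refines_good gs.
- by rewrite -(refines_disjoint st).
- by rewrite -(refines_cover st).
Qed.

Lemma osp_refine s t :
  is_osp d t -> all good_block s -> refines s t -> is_osp d s.
Proof.
rewrite !is_ospE => /and4P[t0 gt dt ct] gs st; apply/and4P; split => //.
- by apply: contraNneq t0 => s0; rewrite s0 in st; case: (t) st.
- by rewrite (refines_disjoint st).
- by rewrite (refines_cover st).
Qed.

(** * Refinement is the order generated by merging *)

(** Merging the first two blocks only loses those [t] that cut right after [A]. If [A = B], then
    [A :|: C] inside [A] would make [C] empty; otherwise removing [A] and then [C] from [B] amounts
    to removing their union. *)
Lemma refines_setU A C s B t : C != set0 -> [disjoint A & C] ->
  refines (A :|: C :: s) (B :: t) =
  (A != B) && refines (A :: C :: s) (B :: t).
Proof.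
move=> C0 AC /=; rewrite {2}/residue; case: (boolP (A \subset B)) => AB /=.
  case: eqVneq => [<-|nAB] /=.
    rewrite subUset subxx /=; case: (boolP (C \subset A)) => // CA.
    by rewrite (disjoint_subset0 AC CA) eqxx in C0.
  rewrite subUset AB subsetD [[disjoint C & A]]disjoint_sym AC andbT /=.
  case: (boolP (C \subset B)) => //= CB.
  rewrite /residue setDDl.
  suff -> : (C == B :\: A) = (A :|: C == B) by [].
  by apply/eqP/eqP => [->|<-]; rewrite ?setUDK // setU_diff.
by rewrite subUset (negbTE AB) andbF.
Qed.

Lemma disjoint_blocks_cons2 A C s :
  disjoint_blocks (A :: C :: s) -> [disjoint A & C].
Proof. by case/andP=> /= /andP[]. Qed.

Lemma disjoint_blocks_behead A s :
  disjoint_blocks (A :: s) -> disjoint_blocks s.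
Proof. by case/andP. Qed.

Lemma merge_blocks0 A C s : merge_blocks (A :: C :: s) 0 = A :|: C :: s.
Proof. by rewrite /merge_blocks /= drop0. Qed.

Lemma refines_merge s t i :
  disjoint_blocks s -> all good_block s -> (i < (size s).-1)%N ->
  refines (merge_blocks s i) t -> refines s t.
Proof.
elim: s t i => [|A [|C s] IHs] // [|B t] [|i] //.
  move=> dA /and3P[_ /andP[C0 _] _] _.
  rewrite merge_blocks0 (refines_setU _ _ _ C0 (disjoint_blocks_cons2 dA)).
  by case/andP.
move=> /disjoint_blocks_behead ds /andP[_ gs] is_ /andP[AB st].
by rewrite [refines _ _]/= AB; apply: (IHs _ i).
Qed.

(** At the first place where the sequences differ, the block of [s] is a proper piece of that of
    [t], so the cut after it is not a cut of [t] and can be erased. *)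
Lemma refines_mergeable s t :
  disjoint_blocks s -> all good_block s -> refines s t -> s != t ->
  exists2 i, (i < (size s).-1)%N & refines (merge_blocks s i) t.
Proof.
elim: s t => [|A s IHs] [|B t] // ds /andP[_ gs] st nst.
case: (eqVneq A B) => [AB|nAB].
  move: st; rewrite /= AB subxx /residue eqxx /= => st.
  case: (IHs t) => //; first exact: disjoint_blocks_behead ds.
    by apply: contra nst => /eqP->; rewrite AB.
  move=> i is_ mt; exists i.+1; first by case: (size s) is_.
  by rewrite /merge_blocks /= subxx /residue eqxx.
case: s {IHs nst} ds gs st => [|C s] ds gs st.
  by move: st; rewrite /= /residue (negbTE nAB) andbF.
exists 0%N => //; rewrite merge_blocks0 refines_setU ?(disjoint_blocks_cons2 ds) ?nAB //.
by case/andP: gs => /andP[].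
Qed.

Lemma osp_leE x y : osp_le x y = refines x y.
Proof.
have ospP (u : osp d n) : disjoint_blocks u /\ all good_block u.
  by case: u => s /=; rewrite is_ospE => /and4P[].
apply/idP/idP.
  case/connectP=> p; elim: p x => [|z p IHp] x /=.
    by move=> _ ->; exact: refines_refl.
  case/andP=> /existsP[i /eqP zE] /IHp{}IHp /IHp zy; have [dx gx] := ospP x.
  by apply: (@refines_merge _ _ i) => //; rewrite -zE.
(* Each merge removes one block, so induction on the number of blocks builds the path of covers. *)
have [m] := ubnP (size x); elim: m x => // m IHm x xm xy.
have [dx gx] := ospP x.
case: (eqVneq (val x) (val y)) => [/val_inj->|nxy]; first exact: connect0.
have [i is_ mt] := refines_mergeable dx gx xy nxy.
have mP : is_osp d (merge_blocks x i).
  apply: (osp_coarsen (valP x)); apply: (refines_merge dx gx is_); exact: refines_refl.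
have xz : osp_cover x (Osp mP) by apply/existsP; exists (Ordinal is_).
apply: (connect_trans (connect1 xz)); apply: IHm => //.
by rewrite -ltnS -(osp_cover_size xz).
Qed.

(** * Enumeration of coarsenings and the alternating sum *)

(** One binary choice per cut: keep the cut after [A], or erase it. The filter leaves out the last
    block, which has no cut after it. *)
Fixpoint coarsenings s : seq (seq {set 'I_n}) :=
  if s is A :: s' then
    [seq A :: z | z <- coarsenings s'] ++
    [seq A :|: head set0 z :: behead z | z <- coarsenings s' & z != [::]]
  else [:: [::]].

Lemma refines_cons_disjoint A s C t :
  disjoint_blocks (A :: s) -> refines s (C :: t) -> [disjoint A & C].
Proof.
case/andP; rewrite disjoint_bigcupE => As _ /refines_cover st.
by rewrite st big_cons in As; apply: disjointWr As; apply: subsetUl.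
Qed.

Lemma refines_cons_head s C t : all good_block s -> refines s (C :: t) -> C != set0.
Proof. by move=> gs /refines_good/(_ gs)/andP[/andP[]]. Qed.

Lemma mem_coarsenings s z : disjoint_blocks s -> all good_block s ->
  (z \in coarsenings s) = refines s z.
Proof.
elim: s z => [|A s IHs] z; first by rewrite inE; case: z.
move=> ds /= /andP[gA gs]; have {}IHs z' := IHs z' (disjoint_blocks_behead ds) gs.
rewrite mem_cat; apply/idP/idP.
  case/orP=> /mapP[z']; first by rewrite IHs => sz ->; rewrite subxx /residue eqxx.
  rewrite mem_filter IHs; case: z' => [|C t] //= st ->.
  have AC := refines_cons_disjoint ds st; have C0 := refines_cons_head gs st.
  rewrite subsetUl /residue setUDK //; case: eqVneq => // AE.
  by rewrite (disjoint_subset0 AC) ?eqxx // AE subsetUr in C0.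
case: z => [|B t] //= /andP[AB]; rewrite /residue; case: eqVneq => [->|nAB] st.
  by rewrite map_f ?IHs.
apply/orP; right; apply/mapP; exists (B :\: A :: t); last by rewrite /= setU_diff.
by rewrite mem_filter IHs.
Qed.

Lemma coarsenings_uniq s :
  disjoint_blocks s -> all good_block s -> uniq (coarsenings s).
Proof.
elim: s => [|A s IHs] //= ds /andP[gA gs].
have ds' := disjoint_blocks_behead ds; have {}IHs := IHs ds' gs.
have hd z C : C :: z \in coarsenings s -> [disjoint A & C] /\ C != set0.
  rewrite mem_coarsenings // => sz.
  by split; [apply: refines_cons_disjoint sz | apply: refines_cons_head sz].
rewrite cat_uniq map_inj_uniq ?IHs; last by move=> ? ? [].
rewrite map_inj_in_uniq ?filter_uniq ?andbT //=.
  apply/hasPn => _ /mapP[y + ->]; rewrite mem_filter => /andP[].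
  case: y => [|C z] //= _ /hd[AC C0].
  apply/mapP => -[z' _ [AE _]].
  by rewrite (disjoint_subset0 AC) ?eqxx // -AE subsetUr in C0.
move=> [|C z] [|C' z']; rewrite !mem_filter //= => /hd[AC _] /hd[AC' _] [E ->].
by rewrite -(setUDK AC) E setUDK.
Qed.

(* If the first blocks of [s] and [t] differ, the coarsenings that keep the   *)
(* first cut of [s] cancel those that drop it.                                *)
Lemma sum_coarsenings s t : disjoint_blocks s -> all good_block s ->
  \sum_(z <- coarsenings s | refines z t) (-1) ^+ size z
    = (-1) ^+ size s *+ (s == t) :> int.
Proof.
elim: s t => [|A s IHs] t; first by rewrite big_mkcond big_seq1; case: t.
move=> ds /= /andP[_ gs]; have ds' := disjoint_blocks_behead ds.
rewrite big_cat !big_map big_filter_cond /=.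
case: t => [|B t] /=; first by rewrite !big_pred0 ?addr0 // => z; rewrite andbF.
(* Pair the two coarsenings that come from the same [z]; their signs are opposite. By [refines_setU]
   only the case [A == B] leaves a term unpaired. *)
transitivity (\sum_(z <- coarsenings s)
    (if (A == B) && refines z t then (-1) ^+ (size z).+1 else 0 : int)).
  rewrite big_mkcond [X in _ + X]big_mkcond -big_split /=.
  apply: eq_big_seq => -[|C z] /=.
    rewrite addr0 /residue; case: eqVneq => [->|_] /=; first by rewrite subxx.
    by rewrite andbF.
  rewrite mem_coarsenings // => sz.
  have := refines_setU z B t (refines_cons_head gs sz) (refines_cons_disjoint ds sz).
  move=> /= ->; rewrite ![residue A B t]/residue; case: eqVneq => [->|_] /=.
    by rewrite subxx addr0 -/(refines (C :: z) t).
  by case: ifP => _; rewrite ?addr0 // exprS mulN1r addNr.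
rewrite eqseq_cons; case: eqP => _ /=; last by rewrite mulr0n big1.
rewrite -big_mkcond /=; under eq_bigr do rewrite exprS.
by rewrite -big_distrr /= IHs // exprS mulrnAr.
Qed.

(** * Enumeration of refinements *)

(* [m] is fuel; it suffices that it bounds the total size of the blocks.      *)
Fixpoint refinements (m : nat) t : seq (seq {set 'I_n}) :=
  match m, t with
  | m'.+1, B :: t' =>
      [seq A :: s | A <- enum [set A : {set 'I_n} | (A \subset B) && good_block A],
                    s <- refinements m' (residue A B t')]
  | _, _ => [:: [::]]
  end.

(** Removing a nonempty piece uses up one unit of fuel. *)
Lemma residue_weight A B t m : A != set0 -> A \subset B ->
  (\sum_(C <- B :: t) #|C| <= m.+1)%N ->
  (\sum_(C <- residue A B t) #|C| <= m)%N.
Proof.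
rewrite big_cons -card_gt0 => A0 AB Bt; rewrite -ltnS; apply: leq_trans Bt.
have AB' := subset_leq_card AB.
rewrite /residue; case: eqP => [AE|_].
  by rewrite -add1n leq_add2r -AE.
rewrite big_cons cardsD (setIidPr AB) -addSn leq_add2r.
by rewrite ltn_subrL A0 (leq_trans A0).
Qed.

Lemma no_weight_nil t :
  all good_block t -> (\sum_(C <- t) #|C| <= 0)%N -> t = [::].
Proof.
case: t => // B t /andP[/andP[B0 _] _]; rewrite big_cons leqn0 addn_eq0 cards_eq0.
by rewrite (negbTE B0).
Qed.

Lemma mem_refinements m t s :
  all good_block t -> (\sum_(B <- t) #|B| <= m)%N ->
  (s \in refinements m t) = all good_block s && refines s t.
Proof.
elim: m t s => [|m IHm] t s gt tm.
  by rewrite (no_weight_nil gt tm) inE refines_nilr; case: s => //= *; rewrite andbF.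
case: t gt tm => [|B t] gt tm.
  by rewrite inE refines_nilr; case: s => //= *; rewrite andbF.
apply/allpairsPdep/idP => [[A [z []]]|].
  rewrite mem_enum inE => /andP[AB gA] + ->.
  rewrite IHm ?(good_residue gA AB gt) ?residue_weight //; last by case/andP: gA.
  by case/andP=> gz zt /=; rewrite gA gz AB.
case: s => [|A z] //=.
case/andP=> /andP[gA gz] /andP[AB zt]; exists A, z; split => //.
  by rewrite mem_enum inE AB.
rewrite IHm ?(good_residue gA AB gt) ?residue_weight ?gz //; by case/andP: gA.
Qed.

Lemma refinements_uniq m t : uniq (refinements m t).
Proof.
elim: m t => [|m IHm] [|B t] //=.
apply: allpairs_uniq_dep; first exact: enum_uniq.
  by move=> A _; apply: IHm.
by move=> [A z] [A' z'] _ _ /= [-> ->].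
Qed.

Lemma sum_card_disjoint s : disjoint_blocks s ->
  (\sum_(B <- s) #|B|)%N = #|\bigcup_(B <- s) B|.
Proof.
elim: s => [|B s IHs]; first by rewrite !big_nil cards0.
rewrite /disjoint_blocks /= disjoint_bigcupE !big_cons => /andP[Bs /IHs->].
by rewrite cardsU (disjoint_setI0 Bs) cards0 subn0.
Qed.


Lemma size_good_blocks s :
  all (@good_block) s -> (size s * d <= \sum_(B <- s) #|B|)%N.
Proof.
elim: s => [|B s IHs] //= /andP[/andP[B0 dB] /IHs ds].
by rewrite big_cons mulSn leq_add // dvdn_leq // card_gt0.
Qed.

(** The strict inequality forces a block of size other than [d], hence larger; a [d]-subset is split
    off the first such block. This supplies the downward steps in [rank_osp]. *)
Lemma split_block t : (0 < d)%N ->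
  all good_block t -> (size t * d < \sum_(B <- t) #|B|)%N ->
  exists s, [/\ all good_block s, refines s t & size s = (size t).+1].
Proof.
move=> d0; elim: t => [|B t IHt]; first by rewrite big_nil.
move=> /= /andP[gB gt]; rewrite big_cons mulSn; have /andP[B0 dB] := gB.
have [Bd|nBd] := eqVneq #|B| d.
  rewrite Bd ltn_add2l => /(IHt gt)[s [gs st ss]].
  by exists (B :: s); rewrite /= gB gs subxx /residue eqxx st ss.
move=> _; have dleB : (d <= #|B|)%N by rewrite dvdn_leq // card_gt0.
have /set0Pn[A] : [set A : {set 'I_n} | (A \subset B) && (#|A| == d)] != set0.
  by rewrite -card_gt0 cards_draws bin_gt0.
rewrite inE => /andP[AB /eqP Ad].
have nAB : A != B by apply: contraNneq nBd => <-; rewrite Ad.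
have gA : good_block A by rewrite /good_block -card_gt0 Ad d0 dvdnn.
exists (A :: (B :\: A) :: t); split => //=; first by rewrite gA gt good_diff.
by rewrite AB /residue (negbTE nAB) /= subxx eqxx refines_refl.
Qed.

End Refinement.

(** * Möbius function and rank in finite posets *)

Section PosetGeneralities.

Variables (disp : Order.disp_t) (P : finPOrderType disp).
Implicit Types x y z : P.

(** The defining recursion determines the values above [x], so a guessed formula only has to be
    checked on interval sums. A general ring is allowed because Euler numbers are rationals here. *)
Lemma moebius_unique (R : nzRingType) (f : P -> R) x :
  (forall y, (x <= y)%O ->
     \sum_(z | (x <= z)%O && (z <= y)%O) f z = (x == y)%:R) ->
  forall y, (x <= y)%O -> (moebius x y)%:~R = f y.
Proof.
move=> fP y; have [m] := ubnP #|[set z | (z < y)%O]|.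
elim: m y => // m IHm y ym xy.
rewrite moebiusE; have := fP y xy; case: eqVneq => [<-|nxy].
  rewrite (big_pred1 x) => [->|z]; first by rewrite mulr1z.
  by rewrite /= eq_sym; apply/andP/eqP => [/andP/le_anti|->]; rewrite ?lexx.
rewrite (bigD1 y) ?xy ?lexx //= => /eqP; rewrite addr_eq0 => /eqP ->.
rewrite rmorphN rmorph_sum /=; congr (- _).
apply: eq_big => z; first by rewrite lt_neqAle [(z != y) && _]andbC andbA.
case/andP=> xz zy; apply: IHm => //.
rewrite -ltnS (leq_trans _ ym) // ltnS; apply/proper_card/properP; split.
  by apply/subsetP => u; rewrite !inE => /lt_trans; apply.
by exists z; rewrite !inE ?ltxx.
Qed.

Lemma rank_lt x y : (x < y)%O -> (rank x < rank y)%N.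
Proof.
move=> xy; rewrite /rank.
pose below u (C : {set P}) := is_chain C && [forall z in C, (z <= u)%O].
have below1 u : below u [set u].
  apply/andP; split; last by apply/forall_inP => z /set1P->.
  by apply/forall_inP => a /set1P->; apply/forall_inP => b /set1P->; rewrite comparablexx.
have [|C /andP[/forall_inP Cc /forall_inP Cx] CE] :=
  @eq_bigmax_cond _ (below x) (fun C => #|C|).
  by apply/card_gt0P; exists [set x]; apply: below1.
have Cy z : z \in C -> (z < y)%O by move/Cx/le_lt_trans; apply.
have yC : y \notin C by apply/negP => /Cy; rewrite ltxx.
have Cy' : below y (y |: C).
  apply/andP; split; last by apply/forall_inP => z /setU1P[->|/Cy/ltW].
  apply/forall_inP => a /setU1P[->|aC]; apply/forall_inP => b /setU1P[->|bC].
  - exact: comparablexx.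
  - by rewrite comparable_sym; apply/lt_comparable/Cy.
  - exact/lt_comparable/Cy.
  - by move/forall_inP: (Cc _ aC); apply.
(* [rank] is a truncated predecessor, so strictness needs a nonempty chain. *)
have C0 : (0 < #|C|)%N.
  by rewrite -CE; apply: leq_trans (leq_bigmax_cond _ (below1 x)); rewrite cards1.
set M := (X in (X.-1 < _)%N); rewrite (CE : M = _) {M}.
have := leq_bigmax_cond (F := fun C : {set P} => #|C|) _ Cy'.
rewrite cardsU1 yC add1n /below; move: C0; case: #|C| => // c _.
by case: (\max_(_ | _) _).
Qed.

End PosetGeneralities.

(** * Identities for the Euler numbers *)

Section EulerNumbers.

Variable d : nat.

Lemma euler0 : euler d 0 = 1.
Proof.
have := euler_egf d 0; rewrite /fps_mul big_ord_recl big_ord0 addr0 /=.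
by rewrite /divisible_exp dvdn0 /= fact0 !divr1.
Qed.

(** Coefficient of x^m in [euler_egf], times m!. As [d] divides [m], the factor of index m - i
    vanishes unless [d] divides i. *)
Lemma euler_sum m : (d %| m)%N -> (0 < m)%N ->
  \sum_(i < m.+1 | (d %| i)%N) euler d i *+ 'C(m, i) = 0.
Proof.
move=> dm m0; have := euler_egf d m; rewrite /fps_one.
move/(congr1 (fun a => (m`!)%:R * a)); rewrite gtn_eqF // mulr0 => E.
rewrite -[RHS]E /fps_mul big_distrr /= big_mkcond; apply: eq_bigr => i _.
have im : (i <= m)%N by rewrite -ltnS.
rewrite /divisible_exp dvdn_subr //; case: ifP => _; last by rewrite !mulr0.
have f0 k : (k`!)%:R != 0 :> rat by rewrite pnatr_eq0 -lt0n fact_gt0.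
rewrite -(bin_fact im) !natrM -mulr_natl.
by field; rewrite !f0.
Qed.

Lemma euler_sum_subsets (T : finType) (B : {set T}) :
  (d %| #|B|)%N -> B != set0 ->
  \sum_(A : {set T} | (A \subset B) && (d %| #|A|)%N) euler d #|A| = 0.
Proof.
rewrite -card_gt0 => dB B0; rewrite -[RHS](euler_sum dB B0).
have AB (A : {set T}) : A \subset B -> (#|A| < #|B|.+1)%N.
  by rewrite ltnS; apply: subset_leq_card.
rewrite (partition_big (fun A : {set T} => inord #|A| : 'I_#|B|.+1)
          (fun i => d %| i)%N) /=; last first.
  by move=> A /andP[/AB ? ?]; rewrite inordK.
apply: eq_bigr => i di.
rewrite -cards_draws -sumr_const; apply: eq_big => [A|A].
  rewrite inE; case: (boolP (A \subset B)) => //= sAB.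
  rewrite -val_eqE /= inordK ?AB //; case: eqP => [->|]; by rewrite ?di ?andbF.
by case/andP=> /andP[/AB sAB _] /eqP <-; rewrite inordK.
Qed.

End EulerNumbers.

(** * Ranks and Möbius values in [Omega] *)

Section Omega.

Variables d n : nat.
Implicit Types (s t : seq {set 'I_n}) (x y : osp d n).

Lemma ospP x : disjoint_blocks x /\ all (@good_block d n) x.
Proof. by case: x => s /=; rewrite is_ospE => /and4P[]. Qed.

Lemma sum_card_osp x : (\sum_(B <- val x) #|B|)%N = n.
Proof.
case: x => s /=; rewrite is_ospE => /and4P[_ _ ds /eqP cs].
by rewrite sum_card_disjoint // cs cardsT card_ord.
Qed.

Lemma Omega_leE x y : (of_osp x <= of_osp y)%O = refines x y.
Proof. exact: osp_leE. Qed.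

Lemma size_osp_leq x : (0 < d)%N -> (size x <= n %/ d)%N.
Proof.
by move=> d0; rewrite leq_divRL // -[leqRHS](sum_card_osp x) size_good_blocks ?(ospP x).2.
Qed.

(** Transfers sums over the poset to the lists enumerated above. *)
Lemma sum_osp (V : nmodType) (P : pred (Omega d n)) (F : Omega d n -> V)
    (G : seq {set 'I_n} -> V) (l : seq (seq {set 'I_n})) :
  uniq l -> all (@is_osp d n) l ->
  (forall x, P (of_osp x) = (val x \in l)) -> ~~ P (\bot)%O ->
  (forall x, F (of_osp x) = G (val x)) ->
  \sum_(z | P z) F z = \sum_(s <- l) G s.
Proof.
move=> ul lP Pl PN FG; pose l' : seq (osp d n) := pmap insub l.
have vl : map val l' = l.
  rewrite /l' (pmap_filter (insubK _)) -[RHS]filter_predT.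
  apply: eq_in_filter => s /(allP lP) sP.
  by rewrite insubT.
rewrite -vl big_map; under [RHS]eq_bigr do rewrite -FG.
rewrite -(big_map (@of_osp d n) predT F) -[LHS]big_filter; apply: perm_big.
apply: uniq_perm.
- by rewrite filter_uniq ?index_enum_uniq.
- rewrite map_inj_uniq; last by move=> ? ? [].
  by rewrite -(map_inj_uniq val_inj) vl.
case=> [x|]; rewrite mem_filter mem_index_enum andbT.
  rewrite mem_map; last by move=> ? ? [].
  by rewrite -(mem_map val_inj) vl Pl.
by rewrite (negbTE PN); apply/esym/negP => /mapP[].
Qed.

Lemma rank_osp x : (0 < d)%N -> (d %| n)%N ->
  rank (of_osp x) = ((n %/ d).+1 - size x)%N.
Proof.
move=> d0 dn; apply/eqP; rewrite eqn_leq; apply/andP; split.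
  have sn := size_osp_leq _ d0.
  rewrite /rank -subn1 leq_subLR add1n; apply/bigmax_leqP => C /andP[Cc Cx].
  (* As elements of a chain, partitions are separated by their sizes, and the *)
  (* minimum takes the next size after the largest possible one, n / d.       *)
  pose f (z : Omega d n) : nat :=
    (if z is Some u then size u - size x else (n %/ d).+1 - size x)%N.
  have fC (z : Omega d n) : z \in C -> (f z < ((n %/ d).+1 - size x).+1)%N.
    by rewrite ltnS /f; case: z => // u _; rewrite leq_sub2r // ltnW // ltnS.
  pose g (z : Omega d n) : 'I_((n %/ d).+1 - size x).+1 := inord (f z).
  rewrite -[leqRHS]card_ord; apply: (leq_card_in g) => a b aC bC gab.
  have {gab} fab : f a = f b by rewrite -(inordK (fC _ aC)) -/(g a) gab inordK ?fC.
  have sx u : Some u \in C -> (size x <= size u)%N.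
    by move=> uC; have /osp_le_size[] := forall_inP Cx _ uC.
  have ab := forall_inP (forall_inP Cc _ aC) _ bC.
  move: a b aC bC fab ab => [u|] [v|] //= uC vC fuv; last 2 first.
  - move=> _; move: (sn u) (sn x) (sx u uC) fuv => *; lia.
  - move=> _; move: (sn v) (sn x) (sx v vC) fuv => *; lia.
  have {fuv} suv : size u = size v by move: (sx _ uC) (sx _ vC) => *; lia.
  case/orP=> /osp_le_size[_]; rewrite suv eqxx => /esym/eqP -> //.
(* Lower bound: split blocks until there are n / d of them; the minimum lies one step below. *)
have [m] := ubnP (n %/ d - size x)%N; elim: m x => // m IHm x xm.
have [nx|xn] := leqP (n %/ d) (size x).
  rewrite (leq_trans (_ : _ <= 1)%N) //; first by lia.
  by apply: (@leq_ltn_trans (rank (\bot%O : Omega d n))) => //; apply: rank_lt.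
have [|s [gs sx ss]] := @split_block d n (val x) d0 (ospP x).2.
  by rewrite sum_card_osp -ltn_divRL.
have sP := osp_refine (valP x) gs sx; pose y : osp d n := Osp sP.
have yx : (of_osp y < of_osp x)%O.
  rewrite lt_neqAle Omega_leE sx andbT; apply: contra_eqN ss => /eqP[<-] /=.
  by rewrite neq_ltn ltnSn.
apply: leq_trans (rank_lt yx); rewrite subSn; last exact: ltnW.
rewrite ltnS -subSS.
have := IHm y; rewrite [size y]ss; apply.
by rewrite subnS prednK ?subn_gt0.
Qed.

Lemma moebius_osp x y : (of_osp x <= of_osp y)%O ->
  moebius (of_osp x) (of_osp y) = (-1) ^+ (size x + size y).
Proof.
(* The value at the minimum is a dummy, since the minimum is not above [x]. Adding the sizes gives
   the parity of their difference without truncation. *)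
pose f (z : Omega d n) : int := if z is Some u then (-1) ^+ (size x + size u) else 0.
move=> xy; rewrite -[LHS]intz (@moebius_unique _ _ _ f) // => {y xy} -[y|] // _.
have [dx gx] := ospP x; have [dy gy] := ospP y.
rewrite (@sum_osp _ _ _ (fun s => (-1) ^+ (size x + size s))
           [seq z <- coarsenings (val x) | refines z (val y)]) //.
- rewrite big_filter; under eq_bigr do rewrite exprD.
  by rewrite -big_distrr /= (@sum_coarsenings d) // mulrnAr -expr2 sqrr_sign.
- by rewrite filter_uniq ?(@coarsenings_uniq d).
- apply/allP => z; rewrite mem_filter (@mem_coarsenings d) // => /andP[_ xz].
  exact: osp_coarsen (valP x) xz.
- by move=> z; rewrite !Omega_leE mem_filter (@mem_coarsenings d) // andbC.
Qed.

Lemma euler_sum_good (B : {set 'I_n}) : good_block d B ->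
  \sum_(A : {set 'I_n} | (A \subset B) && good_block d A) - euler d #|A| = 1.
Proof.
case/andP=> B0 dB; have := euler_sum_subsets dB B0.
(* The empty subset contributes [euler d 0 = 1], which moves to the other side. *)
rewrite (bigD1 set0) ?sub0set ?cards0 ?dvdn0 //= euler0.
move/(canRL (addKr _)); rewrite addr0 sumrN => E.
rewrite -[RHS]opprK -E; congr (- _); apply: eq_bigl => A.
by rewrite /good_block [(A != set0) && _]andbC andbA.
Qed.

Lemma sum_refinements (m : nat) t :
  all (@good_block d n) t -> (\sum_(B <- t) #|B| <= m)%N ->
  \sum_(s <- refinements d m t) \prod_(A <- s) - euler d #|A| = 1.
Proof.
elim: m t => [|m IHm] t gt tm.
  by rewrite (no_weight_nil gt tm) big_seq1 big_nil.
case: t gt tm => [|B t] gt tm; first by rewrite big_seq1 big_nil.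
rewrite /= big_allpairs_dep /= big_enum /=.
have gB : good_block d B by case/andP: gt.
rewrite -[RHS](euler_sum_good gB); apply: eq_big => A; rewrite inE //.
case/andP=> AB gA; under eq_bigr do rewrite big_cons.
rewrite -big_distrr /= IHm ?mulr1 ?(good_residue gA AB gt) ?residue_weight //.
by case/andP: gA.
Qed.

Lemma moebius_bot (y : osp d n) :
  (moebius (\bot%O : Omega d n) (of_osp y))%:~R =
  (-1) ^+ (size y - 1) * \prod_(B <- y) euler d #|B|.
Proof.
pose w s : rat := \prod_(A <- s) - euler d #|A| .
have wE s : w s = (-1) ^+ size s * \prod_(A <- s) euler d #|A|.
  rewrite /w; elim: s => [|A s IHs]; first by rewrite !big_nil mulr1.
  by rewrite !big_cons IHs /= exprS mulrACA mulN1r.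
pose f (z : Omega d n) : rat := if z is Some u then - w (val u) else 1.
have yN0 : (0 < size y)%N by case: y => -[].
rewrite (@moebius_unique _ _ _ f) //.
  rewrite /f /= wE; case: (size y) yN0 => // k _.
  by rewrite subn1 /= exprS mulN1r mulNr opprK.
case=> [z|] _; last first.
  by rewrite (big_pred1 (\bot%O : Omega d n)) // => -[].
have [dz gz] := ospP z.
have zn : (\sum_(B <- val z) #|B| <= n)%N by rewrite sum_card_osp.
(* The minimum contributes 1 and the refinements of [z] contribute -1. *)
rewrite (bigD1 \bot%O) ?lexx //=.
rewrite (@sum_osp _ _ _ (fun s => - w s) (refinements d n (val z))) //.
- by rewrite sumrN sum_refinements // subrr.
- exact: refinements_uniq.
- apply/allP => s; rewrite mem_refinements // => /andP[gs sz].
  exact: osp_refine (valP z) gs sz.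
- move=> u; rewrite andbT mem_refinements // (ospP u).2; exact: Omega_leE.
Qed.

End Omega.

Theorem mainTheorem2 (d n : nat) (hd : (1 <= d)%N) (hn : (d %| n)%N) :
  [/\ (forall psi omega : osp d n,
         (of_osp psi <= of_osp omega)%O ->
         moebius (of_osp psi) (of_osp omega)
           = (-1) ^+ rank_interval (of_osp psi) (of_osp omega)),
      (moebius (\bot%O : Omega d n) (Omega_top d n))%:~R = euler d n
    & (forall omega : osp d n,
         (moebius (\bot%O : Omega d n) (of_osp omega))%:~R
           = (-1) ^+ (size omega - 1) * \prod_(B <- omega) euler d #|B|)].
Proof.
split=> [x y xy||y]; last exact: moebius_bot.
- rewrite moebius_osp // /rank_interval !rank_osp //.
  have sxy : (size y <= size x)%N by have /osp_le_size[] := xy.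
  (* No subtraction truncates, because a partition has at most n / d blocks. *)
  have -> : ((n %/ d).+1 - size y - ((n %/ d).+1 - size x) = size x - size y)%N.
    by have := size_osp_leq x hd; lia.
  by rewrite -[RHS]signr_odd oddB // -oddD signr_odd.
- rewrite /Omega_top; case: insubP => [u _ uE|nP].
    by rewrite -[Some u]/(of_osp u) moebius_bot uE big_seq1 /= cardsT card_ord subnn mul1r.
  (* The one-block sequence can fail to be a partition only by having an empty block; then
     [Omega_top] is the minimum itself. *)
  have n0 : n = 0%N.
    apply/eqP; apply: contraR nP => n0; rewrite is_ospE big_seq1 eqxx /= /good_block.
    by rewrite -card_gt0 cardsT card_ord hn lt0n n0.
  by rewrite moebiusE eqxx n0 euler0.
Qed.
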